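(* Let $(\sigma_i^2,s_i^2)$, $i=1,\dots,N$, follow the hierarchical model in which $\sigma_i^2\overset{iid}{\sim} g$ (an arbitrary prior on $(0,\infty)$) and, conditionally on the variances, the $s_i^2$ are independent with $s_i^2\mid\sigma_i^2\sim \sigma_i^2\chi_k^2/k$. Let $f$ be the marginal probability density function of $s_i^2$. Consider the loss function $$L_1'\left(\sigma^2_{[1:N]},\hat\sigma^2_{[1:N]}\right)=\sum_{i=1}^N\left(\frac{\hat\sigma_i^2}{\sigma_i^2}-1\right)^2 .$$ Then the Bayes rule $(\hat\sigma_{1,B}^{'2},\dots,\hat\sigma_{N,B}^{'2})$ under $L_1'$ is given by $$\hat\sigma_{i,B}^{'2}=\frac{k(k-2)\,s_i^2 f(s_i^2)-2k\,s_i^4 f'(s_i^2)}{4s_i^4 f''(s_i^2)-4(k-2)s_i^2 f'(s_i^2)+k(k-2)f(s_i^2)},\qquad i=1,\dots,N.$$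
   Context: $k$ is the (known) degrees of freedom, $\chi_k^2$ denotes a chi-square random variable with $k$ degrees of freedom, and $p(s^2\mid\sigma^2)$ denotes the density of $s^2$ given $\sigma^2$, i.e. of $\sigma^2\chi^2_k/k$. $g$ denotes the prior density of $\sigma_i^2$. The marginal density of the sample variances is $f(s^2)=\int_0^\infty p(s^2\mid\sigma^2)g(\sigma^2)\,d\sigma^2$ for $s^2>0$. The functions $f,f',f''$ are regarded as functions of the single positive variable $s^2$ (derivatives are taken with respect to $s^2$), and $s_i^4=(s_i^2)^2$. Notation: $\sigma^2_{[1:N]}=(\sigma_1^2,\dots,\sigma_N^2)$, $\hat\sigma^2_{[1:N]}=(\hat\sigma_1^2,\dots,\hat\sigma_N^2)$, $s^2_{[1:N]}=(s_1^2,\dots,s_N^2)$. The Bayes rule for a loss $L$ is the function of the data $s^2_{[1:N]}$ minimizing the posterior expected loss $E[L(\sigma^2_{[1:N]},\hat\sigma^2_{[1:N]})\mid s^2_{[1:N]}]$ over positive $\hat\sigma_1^2,\dots,\hat\sigma_N^2$. *)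

(* Defs.v *)
From HB Require Import structures.
From mathcomp Require Import all_boot all_order all_algebra.
From mathcomp Require Import all_classical all_reals all_analysis.
From mathcomp Require Import measurable_realfun.

Set Implicit Arguments.
Unset Strict Implicit.
Unset Printing Implicit Defensive.

Import Order.TTheory GRing.Theory Num.Theory.
Import numFieldNormedType.Exports.

Local Open Scope classical_set_scope.
Local Open Scope ring_scope.

Definition half_line (R : realType) : set R := `]0, +oo[.
Arguments half_line : clear implicits.

Definition Gamma_fun (R : realType) (a : R) : R :=
  \int[lebesgue_measure]_(t in half_line R) (t `^ (a - 1) * expR (- t)).

Definition chi2_pdf (R : realType) (k : nat) (x : R) : R :=
  if 0 < x then
    x `^ (k%:R / 2 - 1) * expR (- x / 2)
      / (2 `^ (k%:R / 2) * Gamma_fun (k%:R / 2 : R))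
  else 0.

(* Density at [s] of [v * X / k], for [X] chi-square with [k] degrees of
   freedom; [v] stands for sigma^2 and [s] for s^2. *)
Definition cond_pdf (R : realType) (k : nat) (v s : R) : R :=
  k%:R / v * chi2_pdf k (k%:R * s / v).

Definition cond_law (R : realType) (k : nat) (v : R) (B : set R) : \bar R :=
  (\int[lebesgue_measure]_(s in B `&` half_line R) (cond_pdf k v s)%:E)%E.

Definition marginal_pdf (R : realType) (k : nat) (g : R -> R) (s : R) : R :=
  \int[lebesgue_measure]_(v in half_line R) (cond_pdf k v s * g v).

(* The values of [g] outside (0, oo) are irrelevant everywhere below. *)
Definition prior_density (R : realType) (g : R -> R) : Prop :=
  [/\ measurable_fun (half_line R) g,
      (forall v, 0 < v -> 0 <= g v) &
      (\int[lebesgue_measure]_(v in half_line R) (g v)%:E = 1)%E].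

Definition positive_tuple (R : realType) (N : nat) (x : N.-tuple R) : Prop :=
  forall i, 0 < tnth x i.

Section model.
Context (R : realType) (N : nat) (d : measure_display) (Omega : measurableType d)
  (P : probability Omega R).
Implicit Types X Y : 'I_N -> {RV P >-> R}.

Definition random_vector X (w : Omega) : N.-tuple R := [tuple X i w | i < N].

Definition has_density_on_pos (X : {RV P >-> R}) (g : R -> R) : Prop :=
  forall A : set R, measurable A ->
    P (X @^-1` A) =
    (\int[lebesgue_measure]_(v in A `&` half_line R) (g v)%:E)%E.

(* Taking some of the [A i] to be [setT] gives the product rule for all
   subfamilies. *)
Definition mutually_independent X : Prop :=
  forall A : 'I_N -> set R, (forall i, measurable (A i)) ->
    P [set w | forall i, A i (X i w)] = (\prod_(i < N) P (X i @^-1` A i))%E.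

(* Given the vector [X], the [Y i] are independent and [Y i] has law
   [K (X i)]. *)
Definition cond_independent_with_law X Y (K : R -> set R -> \bar R) : Prop :=
  forall (A : set (N.-tuple R)) (B : 'I_N -> set R),
    measurable A -> (forall i, measurable (B i)) ->
    P (random_vector X @^-1` A `&` [set w | forall i, B i (Y i w)]) =
    (\int[P]_(w in random_vector X @^-1` A) \prod_(i < N) K (X i w) (B i))%E.

Definition hierarchical_model (k : nat) (g : R -> R)
    (sigma2 s2 : 'I_N -> {RV P >-> R}) : Prop :=
  [/\ (forall i, has_density_on_pos (sigma2 i) g),
      mutually_independent sigma2 &
      cond_independent_with_law sigma2 s2 (cond_law k)].

Definition likelihood (k : nat) (x v : N.-tuple R) : R :=
  \prod_(i < N) cond_pdf k (tnth v i) (tnth x i).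

(* E[L(sigma2, a) | s2 = x] by Bayes' formula: the posterior has density
   proportional to the likelihood with respect to the prior law of the vector
   sigma2. *)
Definition posterior_expected_loss (k : nat) (sigma2 : 'I_N -> {RV P >-> R})
    (L : N.-tuple R -> N.-tuple R -> R) (x a : N.-tuple R) : \bar R :=
  let v := random_vector sigma2 in
  ((\int[P]_w (L (v w) a * likelihood k x (v w))%:E) /
   (\int[P]_w (likelihood k x (v w))%:E))%E.

(* [r] composed with [S] is a version of E[Y | S], for nonnegative [Y]. *)
Definition cond_expectation_version (S : Omega -> N.-tuple R)
    (Y : Omega -> \bar R) (r : N.-tuple R -> \bar R) : Prop :=
  measurable_fun setT r /\
  forall B : set (N.-tuple R), measurable B ->
    (\int[P]_(w in S @^-1` B) Y w = \int[P]_(w in S @^-1` B) r (S w))%E.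

Definition bayes_action (k : nat) (sigma2 : 'I_N -> {RV P >-> R})
    (L : N.-tuple R -> N.-tuple R -> R) (x a : N.-tuple R) : Prop :=
  positive_tuple a /\
  forall b, positive_tuple b ->
    (posterior_expected_loss k sigma2 L x a <=
     posterior_expected_loss k sigma2 L x b)%E.

End model.

Definition loss1 (R : realType) (N : nat) (v a : N.-tuple R) : R :=
  \sum_(i < N) (tnth a i / tnth v i - 1) ^+ 2.

Definition bayes_formula (R : realType) (k : nat) (f : R -> R) (s : R) : R :=
  (k%:R * (k%:R - 2) * s * f s - 2 * k%:R * s ^+ 2 * f^`()%classic s) /
  (4 * s ^+ 2 * f^`(2)%classic s - 4 * (k%:R - 2) * s * f^`()%classic s
   + k%:R * (k%:R - 2) * f s).

(* Main.v *)
Require Import Defs.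
From HB Require Import structures.
From mathcomp Require Import all_boot all_order all_algebra.
From mathcomp Require Import all_classical all_reals all_analysis.
From mathcomp Require Import measurable_realfun.
From mathcomp Require Import ring lra.

Set Implicit Arguments.
Unset Strict Implicit.
Unset Printing Implicit Defensive.

Import Order.TTheory GRing.Theory Num.Theory.
Import numFieldNormedType.Exports.

Local Open Scope classical_set_scope.
Local Open Scope ring_scope.

(** Put h = k / 2. For v, s > 0 the density of s^2 given sigma^2 = v is
    C s^(h-1) v^-h exp(-hs/v), that is, a multiple of the unnormalised
    inverse-gamma density [invgamma h (h * s)] in v. Integrated against the
    prior, these kernels give the transforms
      T_b(c) = int_0^oo v^-b exp(-c/v) g(v) dv,
    which are finite, positive and satisfy T_b' = - T_(b+1)
    ([is_derive_invgamma_transform]), so that f(s) = C s^(h-1) T_h(hs) is smooth.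

    Under the posterior the coordinates are independent, and multiplying the
    likelihood by 1/v raises the index b by one. The posterior expected loss is
    therefore the sum over i of
      (a_i^2 T_(h+2) - 2 a_i T_(h+1)) / T_h + 1    at c = h s_i
    ([posterior_expected_loss_sum]), a sum of strictly convex parabolas with
    vertices a_i = T_(h+1) / T_(h+2) > 0. Expressing f, f' and f'' through
    T_h, T_(h+1) and T_(h+2), the numerator and the denominator of the announced
    formula become the same multiple of T_(h+1) and T_(h+2), the terms in T_h
    cancelling because 2h = k ([bayes_formulaE]).

    That the ratio defining the posterior expected loss is a conditional
    expectation is Bayes' formula for a joint law with a density
    ([posterior_expectationE]). The model prescribes the conditional law of the
    data only on boxes B_1 x ... x B_N; since boxes form a pi-system, the
    likelihood is the density with respect to the N-fold product of Lebesgue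
    measure ([joint_law_density]).

    The constant C involves Gamma(h). That C <> 0 is read off the model: were C
    zero, the conditional laws, which are part of a probability, would vanish
    ([chi2_const_neq0]). *)

(** * Measures with a density *)

Section density_measure.
Local Open Scope ereal_scope.
Context d (T : measurableType d) (R : realType) (mu : {measure set T -> \bar R}).
Variable f : T -> \bar R.
Hypotheses (mf : measurable_fun setT f) (f0 : forall x, 0 <= f x).

(** The two proofs are arguments because the measure structure depends on
    them. *)
Definition density_measure of measurable_fun setT f & (forall x, 0 <= f x) :=
  fun A : set T => \int[mu]_(x in A) f x.

Local Notation nu := (density_measure mf f0).

Let density0 : nu set0 = 0.
Proof. by rewrite /density_measure integral_set0. Qed.

Let density_ge0 A : 0 <= nu A.
Proof. exact: integral_ge0. Qed.

Let density_sigma_additive : semi_sigma_additive nu.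
Proof.
move=> /= F mF tF mUF; rewrite /density_measure; apply: cvg_toP.
  apply: ereal_nondecreasing_is_cvgn => m n mn.
  by apply: lee_sum_nneg_natr => // k _ _; exact: integral_ge0.
by rewrite ge0_integral_bigcup//=; exact: measurable_funTS.
Qed.

HB.instance Definition _ := isMeasure.Build _ _ _ nu
  density0 density_ge0 density_sigma_additive.

Import HBNNSimple.

(* The density may take the value +oo; the product with the approximations
   still converges, as these are constantly 0 where h is 0. *)
Let cvg_mule_nnsfun_approx (h : T -> \bar R) (mh : measurable_fun setT h) x :
  (forall x, 0 <= h x) ->
  (EFin \o nnsfun_approx measurableT mh n) x * f x @[n --> \oo] --> h x * f x.
Proof.
move=> h0.
have h_cvg := cvg_nnsfun_approx measurableT mh (fun x _ => h0 x) (I : setT x).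
have [hx0|hx_neq0] := eqVneq (h x) 0.
  rewrite hx0 mul0e [X in X @ _ --> _](_ : _ = cst 0); first exact: cvg_cst.
  apply/funext => n /=; suff -> : nnsfun_approx measurableT mh n x = 0%R.
    by rewrite mul0e.
  apply/eqP; rewrite eq_le fun_ge0 andbT -lee_fin nnsfun_approxE.
  have := le_approx n (fun x _ => h0 x) (I : setT x).
  by rewrite hx0.
have [ffin|fNfin] := boolP (f x \is a fin_num); first exact: cvgeZr.
by apply: cvgeM => //; [exact: mule_def_neq0_infty|exact: cvg_cst].
Qed.

Lemma ge0_integral_density (h : T -> \bar R) :
  measurable_fun setT h -> (forall x, 0 <= h x) ->
  \int[nu]_x h x = \int[mu]_x (h x * f x).
Proof.
move=> mh h0; pose h_ := nnsfun_approx measurableT mh.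
have mh_ n : measurable_fun setT (EFin \o h_ n) by exact/measurable_EFinP.
have -> : \int[nu]_x h x = limn (fun n => \int[nu]_x (EFin \o h_ n) x).
  rewrite -monotone_convergence//.
  - apply: eq_integral => x _; apply/esym/cvg_lim => //.
    exact: cvg_nnsfun_approx.
  - by move=> n x _; rewrite lee_fin.
  - by move=> x _ a b ab; rewrite lee_fin; exact/lefP/nd_nnsfun_approx.
have -> : \int[mu]_x (h x * f x) =
    limn (fun n => \int[mu]_x ((EFin \o h_ n) x * f x)).
  rewrite -monotone_convergence//.
  - by apply: eq_integral => x _; apply/esym/cvg_lim => //;
      exact: cvg_mule_nnsfun_approx.
  - by move=> n; exact: emeasurable_funM.
  - by move=> n x _; rewrite mule_ge0// lee_fin.
  - move=> x _ a b ab; apply: lee_wpmul2r => //=.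
    by rewrite lee_fin; exact/lefP/nd_nnsfun_approx.
congr (limn _); apply/funext => n.
have indic_ge0 r x : 0 <= (r * \1_(h_ n @^-1` [set r]) x)%:E.
  by rewrite EFinM nnfun_muleindic_ge0.
have mindic r : measurable_fun setT
    (fun x => (r * \1_(h_ n @^-1` [set r]) x)%:E).
  by apply/measurable_EFinP; exact: measurable_funM.
have h_E x : (EFin \o h_ n) x =
    \sum_(r \in range (h_ n)) (r * \1_(h_ n @^-1` [set r]) x)%:E.
  by rewrite /= fimfunE -fsumEFin.
under [LHS]eq_integral do rewrite h_E.
rewrite [LHS]ge0_integral_fsum//.
under [RHS]eq_integral do rewrite h_E ge0_mule_fsuml//.
rewrite [RHS]ge0_integral_fsum//; last 2 first.
  - by move=> r; exact: emeasurable_funM.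
  - by move=> r x _; rewrite mule_ge0.
apply: eq_fsbigr => r rh.
have r0 : (0 <= r)%R by move: rh; rewrite inE => -[x _ <-].
rewrite integralZl_indic_nnsfun// integral_indic// setIT.
under [RHS]eq_integral do rewrite EFinM -muleA.
rewrite ge0_integralZl//; last 2 first.
  - by apply: emeasurable_funM => //; exact/measurable_EFinP.
  - by move=> x _; rewrite mule_ge0// lee_fin.
congr (_ * _); rewrite /density_measure [LHS]integral_mkcond.
by apply: eq_integral => x _; rewrite epatch_indic muleC.
Qed.

End density_measure.

(** A hypothesis of the form nu A = \int[mu]_(x in A) f x for all measurable A
    says that f is a density of nu; it extends from sets to functions. *)
Lemma ge0_integral_of_density d (T : measurableType d) (R : realType)
    (mu nu : {measure set T -> \bar R}) (f h : T -> \bar R) :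
  measurable_fun setT f -> (forall x, 0 <= f x)%E ->
  (forall A, measurable A -> nu A = \int[mu]_(x in A) f x)%E ->
  measurable_fun setT h -> (forall x, 0 <= h x)%E ->
  (\int[nu]_x h x = \int[mu]_x (h x * f x))%E.
Proof.
move=> mf f0 nuE mh h0; rewrite -(ge0_integral_density mu mf f0)//.
by apply: eq_measure_integral => A mA _; exact: nuE.
Qed.

(** * Product measures on tuples *)

Definition box (T : Type) n (A : 'I_n -> set T) : set (n.-tuple T) :=
  [set t | forall i, A i (tnth t i)].

Section boxes.
Context d (T : measurableType d) (n : nat).
Implicit Types A : 'I_n -> set T.

Lemma measurable_box A : (forall i, measurable (A i)) -> measurable (box A).
Proof.
move=> mA.
rewrite (_ : box A = \bigcap_(i in setT) ((@tnth n T)^~ i @^-1` A i)); last first.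
  by apply/seteqP; split => [t At i _|t At i]; exact: At.
apply: fin_bigcap_measurable => // i _.
by rewrite -[X in measurable X]setTI; exact: measurable_tnth.
Qed.

Definition boxes : set (set (n.-tuple T)) :=
  [set B | exists2 A, (forall i, measurable (A i)) & B = box A].

Lemma setI_closed_boxes : setI_closed boxes.
Proof.
move=> _ _ [A mA ->] [B mB ->]; exists (fun i => A i `&` B i).
  by move=> i; exact: measurableI.
apply/seteqP; split => t /=.
  by move=> [At Bt] i; split; [exact: At|exact: Bt].
by move=> ABt; split => i; case: (ABt i).
Qed.

Lemma boxes_setT : boxes setT.
Proof. by exists (fun=> setT) => //; apply/seteqP; split. Qed.

Lemma measurable_generated_by_boxes :
  (measurable : set (set (n.-tuple T))) = <<s boxes >>.
Proof.
apply/seteqP; split; last first.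
  apply: smallest_sub; first exact: sigma_algebra_measurable.
  by move=> _ [A mA ->]; exact: measurable_box.
apply: smallest_sub; first exact: smallest_sigma_algebra.
rewrite -bigcup_seq => _ [i _ [A mA <-]]; apply: sub_sigma_algebra.
exists (fun j => if j == i then A else setT).
  by move=> j; case: ifP.
rewrite setTI; apply/seteqP; split => t /=.
  by move=> At j; case: eqP => // ->.
by move=> /(_ i); rewrite eqxx.
Qed.

(** The boxes form a pi-system generating the product sigma-algebra, so that a
    finite measure is determined by its values on them. *)
Lemma eq_measure_boxes (R : realType)
    (m1 m2 : {measure set (n.-tuple T) -> \bar R}) :
  (m1 setT < +oo)%E ->
  (forall A, (forall i, measurable (A i)) -> m1 (box A) = m2 (box A)) ->
  forall B, measurable B -> m1 B = m2 B.
Proof.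
move=> m1oo m12 B mB.
apply: (measure_unique boxes (fun=> setT)) => //.
- exact: measurable_generated_by_boxes.
- exact: setI_closed_boxes.
- by move=> _; exact: boxes_setT.
- by rewrite bigcup_const//; exists 0%N.
- by move=> _ [A mA ->]; exact: m12.
Qed.

Lemma indic_box (R : realType) A t :
  (\1_(box A) t)%:E = (\prod_(i < n) (\1_(A i) (tnth t i))%:E : \bar R)%E.
Proof.
rewrite prodEFin; congr EFin; rewrite indicE; case: (boolP (t \in box A)).
  rewrite inE => At; rewrite big1// => i _.
  by rewrite indicE mem_set//; exact: At.
rewrite notin_setE => /existsNP[i Ati].
by apply/esym/eqP/prodf_eq0; exists i; rewrite // indicE memNset.
Qed.

End boxes.

Lemma prode_ge0 (R : realType) I (r : seq I) (P : pred I) (F : I -> \bar R) :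
  (forall i, 0 <= F i)%E -> (0 <= \prod_(i <- r | P i) F i)%E.
Proof. by move=> F0; elim/big_ind: _ => // x y; exact: mule_ge0. Qed.

Lemma emeasurable_prod d (T : measurableType d) (R : realType) I (r : seq I)
    (F : I -> T -> \bar R) :
  (forall i, measurable_fun setT (F i)) ->
  measurable_fun setT (fun x => (\prod_(i <- r) F i x)%E).
Proof.
move=> mF; elim: r => [|i r IHr].
  by under eq_fun do rewrite big_nil; exact: measurable_cst.
by under eq_fun do rewrite big_cons; exact: emeasurable_funM.
Qed.

(** Pairs of pieces of the two covers are enumerated through the encoding of
    nat * nat in nat. *)
Lemma sigma_finite_product d1 d2 (T1 : measurableType d1)
    (T2 : measurableType d2) (R : realType)
    (m1 : {sigma_finite_measure set T1 -> \bar R})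
    (m2 : {sigma_finite_measure set T2 -> \bar R}) :
  sigma_finite setT (m1 \x m2)%E.
Proof.
have [F FT Foo] := sigma_finiteT m1; have [G GT Goo] := sigma_finiteT m2.
pose ij k := odflt (0%N, 0%N) (unpickle k).
exists (fun k => F (ij k).1 `*` G (ij k).2).
  apply/seteqP; split => // -[x y] _.
  have [i _ Fix] : (\bigcup_i F i) x by rewrite -FT.
  have [j _ Gjy] : (\bigcup_j G j) y by rewrite -GT.
  by exists (pickle (i, j)) => //; rewrite /ij pickleK.
move=> k; have [mF Fk] := Foo (ij k).1; have [mG Gk] := Goo (ij k).2.
split; first exact: measurableX.
by rewrite product_measure1E// lte_mul_pinfty// ge0_fin_numE.
Qed.

Lemma sigma_finite_pushforward_cancel d1 d2 (T1 : measurableType d1)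
    (T2 : measurableType d2) (R : realType) (mu : set T1 -> \bar R)
    (f : T1 -> T2) (g : T2 -> T1) :
  cancel f g -> measurable_fun setT g ->
  sigma_finite setT mu -> sigma_finite setT (pushforward mu f).
Proof.
move=> fK mg [F FT Foo]; exists (fun n => g @^-1` F n).
  by rewrite -preimage_bigcup -FT preimage_setT.
move=> n; have [mF muF] := Foo n; split.
  by rewrite -[X in measurable X]setTI; exact: mg.
rewrite /pushforward (_ : f @^-1` (g @^-1` F n) = F n)//.
by apply/seteqP; split => x /=; rewrite fK.
Qed.

(** Built by induction on n, as the image of a binary product measure under
    consing. Tonelli's formula for functions of product form characterises the
    measure, boxes being the special case of indicators. *)
Lemma exists_product_measure_tuple d (T : measurableType d) (R : realType) n
    (mu : 'I_n -> {sigma_finite_measure set T -> \bar R}) :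
  exists m : {sigma_finite_measure set (n.-tuple T) -> \bar R},
    forall h : 'I_n -> T -> \bar R,
      (forall i, measurable_fun setT (h i)) -> (forall i x, 0 <= h i x)%E ->
      (\int[m]_t \prod_(i < n) h i (tnth t i) =
       \prod_(i < n) \int[mu i]_x h i x)%E.
Proof.
elim: n mu => [mu|n IHn mu].
  exists (\d_ [tuple]) => h mh h0.
  under eq_integral do rewrite big_ord0.
  by rewrite big_ord0 integral_dirac ?diracT ?mul1e.
have [m mE] := IHn (fun i => mu (lift ord0 i)).
pose f (p : T * n.-tuple T) : n.+1.-tuple T := [tuple of p.1 :: p.2].
pose g (t : n.+1.-tuple T) : T * n.-tuple T := (thead t, [tuple of behead t]).
have mf : measurable_fun setT f by exact: measurable_cons.
have mg : measurable_fun setT g.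
  apply/measurable_fun_pair; first exact: measurable_tnth.
  exact: measurable_behead.
have fK : cancel f g.
  by move=> [x t]; rewrite /f /g theadE; congr pair; exact/val_inj.
pose m12 : {measure set (T * n.-tuple T)%type -> \bar R} := (mu ord0 \x m)%E.
have sf := sigma_finite_pushforward_cancel fK mg (sigma_finite_product (mu ord0) m).
pose M0 : {measure set (n.+1.-tuple T) -> \bar R} :=
  pushforward m12 f.
pose M : {sigma_finite_measure set (n.+1.-tuple T) -> \bar R} :=
  HB.pack (Measure.sort (M0 mf)) (Measure_isSigmaFinite.Build _ _ _ (M0 mf) sf).
exists M => h mh h0.
have mtnth i : measurable_fun setT (fun t : n.+1.-tuple T => h i (tnth t i)).
  exact: (measurableT_comp (mh i) (measurable_tnth i)).
have mtnth' i :
    measurable_fun setT (fun t : n.-tuple T => h (lift ord0 i) (tnth t i)).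
  exact: (measurableT_comp (mh _) (measurable_tnth i)).
transitivity (\int[m12]_p
    (h ord0 p.1 * \prod_(i < n) h (lift ord0 i) (tnth p.2 i)))%E.
  rewrite (@ge0_integral_pushforward _ _ _ _ _ f mf m12 setT)//.
  - rewrite preimage_setT; apply: eq_integral => p _ /=.
    rewrite big_ord_recl; congr (_ * _)%E; apply: eq_bigr => i _.
    by rewrite tnthS.
  - exact: emeasurable_prod.
  - by move=> t _; exact: prode_ge0.
rewrite fubini_tonelli1//; last 2 first.
  - apply: emeasurable_funM; first exact: measurableT_comp.
    exact: (measurableT_comp (emeasurable_prod _ mtnth')).
  - by move=> p; rewrite mule_ge0// prode_ge0.
rewrite /fubini_F /= big_ord_recl -mE//.
under eq_integral => x _.
  rewrite ge0_integralZl//; last 2 first.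
    - exact: emeasurable_prod.
    - by move=> t _; exact: prode_ge0.
  over.
rewrite ge0_integralZr//.
by apply: integral_ge0 => t _; exact: prode_ge0.
Qed.

Lemma product_measure_tuple_box d (T : measurableType d) (R : realType) n
    (mu : 'I_n -> {measure set T -> \bar R})
    (m : {measure set (n.-tuple T) -> \bar R}) :
  (forall h : 'I_n -> T -> \bar R,
    (forall i, measurable_fun setT (h i)) -> (forall i x, 0 <= h i x)%E ->
    (\int[m]_t \prod_(i < n) h i (tnth t i) =
     \prod_(i < n) \int[mu i]_x h i x)%E) ->
  forall A, (forall i, measurable (A i)) ->
    m (box A) = (\prod_(i < n) mu i (A i))%E.
Proof.
move=> mE A mA; have mB := measurable_box mA.
rewrite -[box A]setIT -integral_indic//.
under eq_integral do rewrite indic_box.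
rewrite (mE (fun i x => (\1_(A i) x)%:E))//; last first.
  by move=> i; exact/measurable_EFinP.
by apply: eq_bigr => i _; rewrite integral_indic// setIT.
Qed.

(** * Independent random variables *)

Section independence.
Context (R : realType) (N : nat) (d : measure_display)
  (Omega : measurableType d) (P : probability Omega R).
Implicit Types X : 'I_N -> {RV P >-> R}.

Lemma measurable_random_vector X : measurable_fun setT (random_vector X).
Proof.
apply/measurable_fun_tnthP => i; rewrite (_ : _ \o _ = X i)//.
by apply/funext => w /=; rewrite tnth_mktuple.
Qed.

(** The joint law and the product of the marginal laws agree on boxes, hence
    everywhere. *)
Lemma mutually_independent_integral_prod X (h : 'I_N -> R -> \bar R) :
  mutually_independent X -> (forall i, measurable_fun setT (h i)) ->
  (forall i x, 0 <= h i x)%E ->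
  (\int[P]_w \prod_(i < N) h i (X i w) =
   \prod_(i < N) \int[P]_w h i (X i w))%E.
Proof.
move=> Xind mh h0.
have [m mE] := exists_product_measure_tuple (fun i => distribution P (X i)).
have mV := measurable_random_vector X.
pose law : {measure set (N.-tuple R) -> \bar R} :=
  pushforward P (random_vector X).
have lawE : forall B, measurable B -> law mV B = m B.
  apply: eq_measure_boxes.
    by rewrite /law /= /pushforward preimage_setT probability_setT ltry.
  move=> A mA; rewrite (product_measure_tuple_box mE)// -Xind//.
  congr (P _); apply/seteqP; split => w /= Aw i.
    by have := Aw i; rewrite tnth_mktuple.
  by rewrite tnth_mktuple; exact: Aw.
have mhtnth : measurable_fun setT
    (fun t : N.-tuple R => \prod_(i < N) h i (tnth t i))%E.
  apply: emeasurable_prod => i.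
  exact: (measurableT_comp (mh i) (measurable_tnth i)).
transitivity (\int[law mV]_t \prod_(i < N) h i (tnth t i))%E.
  rewrite (@ge0_integral_pushforward _ _ _ _ _ _ mV P setT)//.
    rewrite preimage_setT; apply: eq_integral => w _ /=.
    by apply: eq_bigr => i _; rewrite tnth_mktuple.
  by move=> t _; exact: prode_ge0.
rewrite (eq_measure_integral m); last by move=> B mB _; exact: lawE.
rewrite mE//; apply: eq_bigr => i _.
by rewrite ge0_integral_distribution.
Qed.

End independence.

(** * Bayes' formula for a joint law with a density *)

Lemma measurable_invr (R : realType) :
  measurable_fun setT (@GRing.inv R).
Proof.
rewrite (_ : GRing.inv = fun x : R =>
    if 0 <= x then x `^ (-1) else - ((- x) `^ (-1))); last first.
  apply/funext => x; case: ifPn => [x0|]; first by rewrite powR_inv1.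
  by rewrite -ltNge => x0; rewrite powR_inv1 ?oppr_ge0 ?ltW// invrN opprK.
apply: measurable_fun_ifT.
- exact: measurable_fun_ler.
- exact: measurable_powR.
- apply: measurableT_comp => //.
  by apply: (measurableT_comp (measurable_powR _)); exact: oppr_measurable.
Qed.

Lemma emeasurable_funV d (T : measurableType d) (R : realType) (f : T -> \bar R) :
  (forall x, f x \is a fin_num) -> measurable_fun setT f ->
  measurable_fun setT (fun x => (f x)^-1)%E.
Proof.
move=> ffin mf.
have mff : measurable_fun setT (fine \o f).
  exact: (measurableT_comp (fine_measurable measurableT)).
rewrite (_ : (fun x => _) = fun x =>
    if fine (f x) == 0 then +oo%E else (fine (f x))^-1%:E); last first.
  by apply/funext => x; rewrite -{1}(fineK (ffin x)) inver.
apply: measurable_fun_ifT => //.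
  exact: measurable_fun_eqr.
by apply/measurable_EFinP; exact: (measurableT_comp (@measurable_invr R)).
Qed.

Lemma integral_mule_indic d (T : measurableType d) (R : realType)
    (mu : {measure set T -> \bar R}) (D : set T) (f : T -> \bar R) :
  (\int[mu]_(x in D) f x = \int[mu]_x (f x * (\1_D x)%:E))%E.
Proof.
by rewrite integral_mkcond; apply: eq_integral => x _; rewrite epatch_indic.
Qed.

Section bayes_formula_density.
Local Open Scope ereal_scope.
Context d d1 d2 (Omega : measurableType d) (T1 : measurableType d1)
  (T2 : measurableType d2) (R : realType) (P : probability Omega R)
  (mu : {sigma_finite_measure set T2 -> \bar R}).
Variables (V : Omega -> T1) (S : Omega -> T2) (lik : T1 * T2 -> \bar R)
  (L : T1 -> \bar R).
Hypotheses (mV : measurable_fun setT V) (mS : measurable_fun setT S)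
  (mlik : measurable_fun setT lik) (lik0 : forall p, 0 <= lik p)
  (mL : measurable_fun setT L) (L0 : forall v, 0 <= L v).

Hypothesis cond_density : forall A B, measurable A -> measurable B ->
  P (V @^-1` A `&` S @^-1` B) =
  \int[P]_(w in V @^-1` A) \int[mu]_(x in B) lik (V w, x).

Let den x := \int[P]_w lik (V w, x).
Let num x := \int[P]_w (L (V w) * lik (V w, x)).

Hypothesis den_fin : forall x, den x \is a fin_num.

Let mVlik : measurable_fun setT (fun p : Omega * T2 => lik (V p.1, p.2)).
Proof.
apply: (measurableT_comp mlik).
by apply/measurable_fun_pair => //; exact: measurableT_comp.
Qed.

Let mVlik2 w : measurable_fun setT (fun x => lik (V w, x)).
Proof. exact: (measurableT_comp mVlik (pair1_measurable w)). Qed.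

Let mVlik1 x : measurable_fun setT (fun w => lik (V w, x)).
Proof. exact: (measurableT_comp mVlik (pair2_measurable x)). Qed.

Let mLV : measurable_fun setT (fun w => L (V w)).
Proof. exact: (measurableT_comp mL). Qed.

Let mLVlik : measurable_fun setT
  (fun p : Omega * T2 => L (V p.1) * lik (V p.1, p.2)).
Proof.
by apply: emeasurable_funM => //; exact: (measurableT_comp mLV).
Qed.

Let mden : measurable_fun setT den.
Proof.
exact: (measurable_fun_fubini_tonelli_G (m1 := P)
  (fun p : Omega * T2 => lik (V p.1, p.2))).
Qed.

Let mnum : measurable_fun setT num.
Proof.
apply: (measurable_fun_fubini_tonelli_G (m1 := P)
  (fun p : Omega * T2 => L (V p.1) * lik (V p.1, p.2))) => //.
by move=> p; rewrite mule_ge0.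
Qed.

Let den0 x : 0 <= den x. Proof. by apply: integral_ge0. Qed.

Let num0 x : 0 <= num x.
Proof. by apply: integral_ge0 => w _; rewrite mule_ge0. Qed.

Lemma measurable_posterior_expectation :
  measurable_fun setT (fun x => num x / den x).
Proof. by apply: emeasurable_funM => //; exact: emeasurable_funV. Qed.

(* This is what makes the convention 0 / 0 = 0 * +oo = 0 harmless below. *)
Let num_eq0 x : den x = 0 -> num x = 0.
Proof.
move=> dx0; rewrite /num -(integral0 P setT).
apply: ge0_ae_eq_integral => //.
- by apply: emeasurable_funM.
- by move=> w _; rewrite mule_ge0.
have : ae_eq P setT (fun w => lik (V w, x)) (cst 0).
  apply/(ae_eq_integral_abs P) => //.
  by rewrite -[RHS]dx0; apply: eq_integral => w _; rewrite gee0_abs.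
by apply: filterS => w /= /(_ I) ->; rewrite mule0.
Qed.

Let num_denK x : num x / den x * den x = num x.
Proof.
have [dx0|dx_neq0] := eqVneq (den x) 0; first by rewrite dx0 mule0 num_eq0.
rewrite -muleA; move: dx_neq0; rewrite -(fineK (den_fin x)) eqe => dx_neq0.
by rewrite inver (negbTE dx_neq0) -EFinM mulVf// mule1.
Qed.

Let indicE0 (T : Type) (D : set T) x : 0 <= (\1_D x)%:E :> \bar R.
Proof. by rewrite lee_fin. Qed.

Let joint_integral B : measurable B ->
  \int[P]_w (L (V w) * \int[mu]_(x in B) lik (V w, x)) =
  \int[mu]_x (num x * (\1_B x)%:E).
Proof.
move=> mB.
have mB1 : measurable_fun setT (fun x => (\1_B x)%:E : \bar R).
  exact/measurable_EFinP.
pose F (p : Omega * T2) := L (V p.1) * lik (V p.1, p.2) * (\1_B p.2)%:E.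
have mF : measurable_fun setT F.
  by apply: emeasurable_funM => //; exact: (measurableT_comp mB1).
have F0 p : 0 <= F p by rewrite /F !mule_ge0.
transitivity (\int[P]_w \int[mu]_x F (w, x)).
  apply: eq_integral => w _; rewrite integral_mule_indic -ge0_integralZl//.
  - by apply: eq_integral => x _; rewrite muleA.
  - exact: emeasurable_funM.
  - by move=> x _; exact: mule_ge0.
rewrite (fubini_tonelli F)//; apply: eq_integral => x _.
rewrite /num -ge0_integralZr//; first exact: (measurableT_comp mLVlik (pair2_measurable x)).
by move=> w _; exact: mule_ge0.
Qed.

(* For fixed B, the measure P(V in _, S in B) has a density with respect to the
   law of V, namely the conditional probability of S in B. *)
Let integral_V B : measurable B ->
  \int[P]_(w in S @^-1` B) L (V w) =
  \int[P]_w (L (V w) * \int[mu]_(x in B) lik (V w, x)).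
Proof.
move=> mB.
have mSB : measurable (S @^-1` B).
  by rewrite -[X in measurable X]setTI; exact: mS.
have mVA A : measurable A -> measurable (V @^-1` A).
  by move=> mA; rewrite -[X in measurable X]setTI; exact: mV.
have mSB1 : measurable_fun setT (fun w => (\1_(S @^-1` B) w)%:E : \bar R).
  exact/measurable_EFinP.
have mB1 : measurable_fun setT (fun x => (\1_B x)%:E : \bar R).
  exact/measurable_EFinP.
pose q v := \int[mu]_(x in B) lik (v, x).
have mq : measurable_fun setT q.
  rewrite (_ : q = fubini_F mu (fun p => lik p * (\1_B p.2)%:E)); last first.
    by apply/funext => v; rewrite /q integral_mule_indic.
  apply: measurable_fun_fubini_tonelli_F => //.
    by apply: emeasurable_funM => //; exact: (measurableT_comp mB1).
  by move=> p; exact: mule_ge0.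
have q0 v : 0 <= q v by exact: integral_ge0.
pose PB := density_measure P mSB1 (indicE0 (S @^-1` B)).
pose nuB : {measure set T1 -> \bar R} := pushforward PB V.
pose lawV : {measure set T1 -> \bar R} := pushforward P V.
have nuBE A : measurable A -> nuB mV A = \int[lawV mV]_(v in A) q v.
  move=> mA; rewrite (@ge0_integral_pushforward _ _ _ _ _ _ mV P A)//; last first.
    exact: measurable_funTS.
  transitivity (P (V @^-1` A `&` S @^-1` B)); last exact: cond_density.
  have -> : nuB mV A = \int[P]_(w in V @^-1` A) (\1_(S @^-1` B) w)%:E by [].
  by rewrite (integral_indic P (mVA A mA) mSB) setIC.
transitivity (\int[nuB mV]_v L v).
  rewrite (@ge0_integral_pushforward _ _ _ _ _ _ mV PB setT)// preimage_setT.
  rewrite ge0_integral_density//; last by move=> w; exact: L0.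
  exact: integral_mule_indic.
rewrite (ge0_integral_of_density mq q0 nuBE)//.
rewrite (@ge0_integral_pushforward _ _ _ _ _ _ mV P setT)// ?preimage_setT//.
  exact: emeasurable_funM.
by move=> v _; exact: mule_ge0.
Qed.

(* The denominator is the density of the law of S. *)
Let integral_S h : measurable_fun setT h -> (forall x, 0 <= h x) ->
  \int[P]_w h (S w) = \int[mu]_x (h x * den x).
Proof.
move=> mh h0.
pose lawS : {measure set T2 -> \bar R} := pushforward P S.
transitivity (\int[lawS mS]_x h x).
  by rewrite (@ge0_integral_pushforward _ _ _ _ _ _ mS P setT)// preimage_setT.
apply: ge0_integral_of_density => // B mB.
rewrite [LHS](_ : _ = P (V @^-1` setT `&` S @^-1` B)); last first.
  by rewrite preimage_setT setTI.
rewrite cond_density// preimage_setT.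
have mB1 : measurable_fun setT (fun x => (\1_B x)%:E : \bar R).
  exact/measurable_EFinP.
rewrite [RHS]integral_mule_indic.
under [LHS]eq_integral do rewrite integral_mule_indic.
pose F (p : Omega * T2) := lik (V p.1, p.2) * (\1_B p.2)%:E.
rewrite (fubini_tonelli F)//; last 2 first.
- by apply: emeasurable_funM => //; exact: (measurableT_comp mB1).
- by move=> p; exact: mule_ge0.
by apply: eq_integral => x _; rewrite /den -ge0_integralZr.
Qed.

(** Both sides are the integral of the numerator over B: on the left by Tonelli,
    on the right because the denominator is the density of S. *)
Lemma posterior_expectationE B : measurable B ->
  \int[P]_(w in S @^-1` B) L (V w) =
  \int[P]_(w in S @^-1` B) (num (S w) / den (S w)).
Proof.
move=> mB; rewrite integral_V// joint_integral//.
have mr := measurable_posterior_expectation.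
have r0 x : 0 <= num x / den x by rewrite mule_ge0// inve_ge0.
have mB1 : measurable_fun setT (fun x => (\1_B x)%:E : \bar R).
  exact/measurable_EFinP.
rewrite [RHS]integral_mule_indic.
rewrite (integral_S (h := fun x => num x / den x * (\1_B x)%:E)); last 2 first.
- exact: emeasurable_funM.
- by move=> x; exact: mule_ge0.
by apply: eq_integral => x _; rewrite muleAC num_denK.
Qed.

End bayes_formula_density.

(** * Inverse-gamma transforms of a prior density *)

(** The inverse-gamma density of shape b - 1 and scale c, without its
    normalising constant. *)
Definition invgamma (R : realType) (b c v : R) : R :=
  v `^ (- b) * expR (- (c / v)).

Definition invgamma_transform (R : realType) (g : R -> R) (b c : R) : R :=
  \int[lebesgue_measure]_(v in half_line R) (invgamma b c v * g v).

Section invgamma.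
Context {R : realType}.
Implicit Types (b c v : R) (g : R -> R).

Local Notation mu := (@lebesgue_measure R).

Lemma half_lineP v : half_line R v <-> 0 < v.
Proof. by rewrite /half_line /= in_itv/= andbT. Qed.

Lemma measurable_half_line : measurable (half_line R).
Proof. exact: measurable_itv. Qed.

Lemma invgamma_ge0 b c v : 0 <= invgamma b c v.
Proof. by rewrite mulr_ge0 ?powR_ge0 ?expR_ge0. Qed.

Lemma invgamma_gt0 b c v : 0 < v -> 0 < invgamma b c v.
Proof. by move=> v0; rewrite mulr_gt0 ?powR_gt0 ?expR_gt0. Qed.

Lemma invgammaD1 b c v : 0 < v -> invgamma (b + 1) c v = v^-1 * invgamma b c v.
Proof.
move=> v0; rewrite /invgamma opprD powRD; last by rewrite (gt_eqF v0) implybT.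
by rewrite powR_inv1 ?ltW// mulrCA mulrA.
Qed.

Lemma measurable_invgamma b : measurable_fun setT (fun p : R * R => invgamma b p.1 p.2).
Proof.
apply: measurable_funM; first exact: (measurableT_comp (measurable_powR _)).
apply: (measurableT_comp (@measurable_expR R)); apply: measurableT_comp => //.
apply: measurable_funM => //.
exact: (measurableT_comp (@measurable_invr R)).
Qed.

(** The supremum over v is finite because, in the variable u = 1 / v, the
    exponential decay beats the power; ln y < y at y = c0 / (b v) is enough. *)
Lemma invgamma_bounded b c0 : 0 < b -> 0 < c0 ->
  exists M, forall c v, c0 <= c -> 0 < v -> invgamma b c v <= M.
Proof.
move=> b0 c0_gt0; exists (expR (- (b * ln (c0 / b)))) => c v cc v0.
rewrite /invgamma /powR gt_eqF// -expRD ler_expR.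
have c0b : 0 < c0 / b by rewrite divr_gt0.
have /ltW : ln (c0 / b / v) < c0 / b / v by rewrite ln_sublinear// divr_gt0.
rewrite ln_div ?posrE// -(ler_pM2l b0) mulrBr [leRHS](_ : _ = c0 / v); last first.
  by field; rewrite !gt_eqF.
have : c0 / v <= c / v by rewrite ler_pM2r ?invr_gt0.
by lra.
Qed.

Lemma integrable_prior g : prior_density g ->
  mu.-integrable (half_line R) (EFin \o g).
Proof.
move=> [mg g0 g1]; apply/integrableP; split; first exact/measurable_EFinP.
rewrite [ltLHS](_ : _ = 1%E) ?ltry// -g1.
by apply: eq_integral => v /[!inE] /half_lineP v0; rewrite /= ger0_norm// g0.
Qed.

Lemma integrable_invgamma g b c : prior_density g -> 0 < b -> 0 < c ->
  mu.-integrable (half_line R) (EFin \o (fun v => invgamma b c v * g v)).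
Proof.
move=> gp b0 c0; have [mg g0 g1] := gp; have mH := measurable_half_line.
have [M leM] := invgamma_bounded b0 c0.
have mf : measurable_fun (half_line R) (EFin \o (fun v => invgamma b c v * g v)).
  apply/measurable_EFinP; apply: measurable_funM => //.
  apply: measurable_funTS.
  exact: (measurableT_comp (measurable_invgamma b) (pair1_measurable c)).
have Mg := integrableZl _ M (integrable_prior gp).
apply: (le_integrable _ _ _ (Mg mH)) => //= v /half_lineP v0.
rewrite lee_fin !(normrM _ (g v)) ler_wpM2r//.
by apply: le_trans (ler_norm _); rewrite ger0_norm ?invgamma_ge0// leM.
Qed.

Lemma is_derive_invgamma b c v : 0 < v ->
  is_derive c 1 (fun c => invgamma b c v) (- invgamma (b + 1) c v).
Proof.
move=> v0; rewrite invgammaD1// /invgamma.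
have dlin : is_derive c 1 (fun x : R => - (x / v)) (- v^-1).
  rewrite (_ : (fun x => _) = (- v^-1) \*: (id : R -> R)).
    by apply: is_derive_eq; rewrite /GRing.scale /= mulr1.
  by apply/funext => x /=; rewrite /GRing.scale /= mulNr mulrC.
have dexp := @is_derive1_comp R (@expR R) (fun x => - (x / v)) c _ _
  (is_derive_expR _) dlin.
rewrite (_ : (fun x => _) =
    v `^ (- b) \*: ((@expR R \o (fun x => - (x / v))) : R -> R)); last first.
  by apply/funext => x.
apply: is_derive_eq; rewrite /GRing.scale /=; ring.
Qed.

(** Differentiation under the integral sign: for scales near c the derivative
    of the integrand is dominated by a constant multiple of g. *)
Lemma is_derive_invgamma_transform g b c : prior_density g -> 0 < b -> 0 < c ->
  is_derive c 1 (invgamma_transform g b) (- invgamma_transform g (b + 1) c).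
Proof.
move=> gp b0 c0.
have c20 : 0 < c / 2 by rewrite divr_gt0.
have b1_gt0 : 0 < b + 1 by rewrite addr_gt0.
have [M leM] := invgamma_bounded b1_gt0 c20.
have Ic : `]c / 2, c + 1[%classic c.
  by rewrite /= in_itv/= ltrDl ltr01 andbT ltr_pdivrMr// ltr_pMr// ltr1n.
have I_gt (x : R) : `]c / 2, c + 1[%classic x -> c / 2 <= x.
  by rewrite /= in_itv/= => /andP[/ltW].
have I_gt0 (x : R) : `]c / 2, c + 1[%classic x -> 0 < x.
  by move=> /I_gt; exact: lt_le_trans.
have mH := measurable_half_line.
pose f (x v : R) := invgamma b x v * g v.
have fE (x v : R) : 0 < v -> is_derive x 1 (f ^~ v) (- invgamma (b + 1) x v * g v).
  move=> v0; have dx := is_derive_invgamma b x v0.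
  rewrite (_ : f ^~ v = g v \*: ((fun c => invgamma b c v) : R -> R)).
    by apply: is_derive_eq; rewrite /GRing.scale /= mulrC.
  by apply/funext => z; rewrite /f mulrC.
have d1fE (x v : R) : 0 < v -> partial1of2 f x v = - invgamma (b + 1) x v * g v.
  by move=> v0; rewrite partial1of2E; have [_ ->] := fE x v v0.
have int_f x : `]c / 2, c + 1[%classic x ->
    mu.-integrable (half_line R) (EFin \o f x).
  by move=> /I_gt0 x0; exact: integrable_invgamma.
have derf (x v : R) : `]c / 2, c + 1[%classic x -> half_line R v ->
    derivable (f ^~ v) x 1.
  by move=> _ /half_lineP v0; have [] := fE x v v0.
pose G v := `|M| * `|g v|.
have G0 v : 0 <= G v by rewrite mulr_ge0.
have intG : mu.-integrable (half_line R) (EFin \o G).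
  have [mg g0 g1] := gp.
  have Mg := integrableZl _ `|M| (integrable_norm (integrable_prior gp)).
  exact: (Mg mH).
have G_ub x v : `]c / 2, c + 1[%classic x -> half_line R v ->
    `|partial1of2 f x v| <= G v.
  move=> Ix /half_lineP v0; rewrite d1fE// (normrM _ (g v)) normrN ler_wpM2r//.
  rewrite ger0_norm ?invgamma_ge0// (le_trans _ (ler_norm _))// leM//.
  exact: I_gt.
have der := @derivable_under_integral _ _ _ mu f _ mH _ _ _ Ic int_f derf
  _ G0 intG G_ub.
have derE := @differentiation_under_integral _ _ _ mu f _ mH _ _ _ Ic int_f derf
  _ G0 intG G_ub.
apply: DeriveDef; first exact: der.
rewrite -derive1E [LHS]derE.
transitivity (\int[mu]_(v in half_line R) (-1 * (invgamma (b + 1) c v * g v))).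
  apply: eq_Rintegral => v /[!inE] /half_lineP v0.
  by rewrite d1fE// mulN1r mulNr.
have int1 := @integrable_invgamma g _ _ gp b1_gt0 c0.
have := @RintegralZl _ _ R mu (half_line R) _ (-1) mH int1.
by rewrite mulN1r.
Qed.

Lemma invgamma_transform_ge0 g b c : prior_density g ->
  0 <= invgamma_transform g b c.
Proof.
move=> [_ g0 _]; apply: Rintegral_ge0 => v /half_lineP v0.
by rewrite mulr_ge0 ?invgamma_ge0 ?g0.
Qed.

Lemma EFin_invgamma_transform g b c : prior_density g -> 0 < b -> 0 < c ->
  (invgamma_transform g b c)%:E =
  (\int[mu]_(v in half_line R) (invgamma b c v * g v)%:E)%E.
Proof.
move=> gp b0 c0; have ig := integrable_invgamma gp b0 c0.
rewrite fineK//; apply: integrable_fin_num ig; exact: measurable_half_line.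
Qed.

(** A vanishing integral would force g = 0 almost everywhere, against the total
    mass 1. *)
Lemma invgamma_transform_gt0 g b c : prior_density g -> 0 < b -> 0 < c ->
  0 < invgamma_transform g b c.
Proof.
move=> gp b0 c0; rewrite lt_neqAle invgamma_transform_ge0// andbT eq_sym.
apply/eqP => int0.
have [mg g0 g1] := gp.
have mH := measurable_half_line.
have mf := measurable_int _ (integrable_invgamma gp b0 c0).
have f0 : ae_eq mu (half_line R)
    (EFin \o (fun v => invgamma b c v * g v)) (cst 0%E).
  apply/ae_eq_integral_abs => //.
  have := EFin_invgamma_transform gp b0 c0; rewrite int0 => E0.
  rewrite [RHS]E0; apply: eq_integral => v /[!inE] /half_lineP v0.
  by rewrite gee0_abs// lee_fin mulr_ge0 ?invgamma_ge0 ?g0.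
suff : (\int[mu]_(v in half_line R) (g v)%:E = 0)%E.
  by rewrite g1 => /eqP; rewrite onee_eq0.
rewrite -[RHS](integral0 mu (half_line R)).
apply: ge0_ae_eq_integral => //.
- exact/measurable_EFinP.
- by move=> v /half_lineP v0; rewrite lee_fin g0.
apply: filterS f0 => v /[swap] Hv /(_ Hv) /= [] /eqP.
have v0 : 0 < v by apply/half_lineP.
by rewrite mulf_eq0 gt_eqF ?invgamma_gt0//= => /eqP ->.
Qed.

End invgamma.

(** * The scaled chi-square density and the marginal density *)

Section chi2.
Context (R : realType) (k : nat).
Hypothesis k_gt0 : (0 < k)%N.
Implicit Types (v s : R).

Local Notation mu := (@lebesgue_measure R).
Local Notation h := (k%:R / 2 : R).

Let h_gt0 : 0 < h. Proof. by rewrite divr_gt0// ltr0n. Qed.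

Definition chi2_const : R := h `^ h / Gamma_fun h.

Lemma chi2_const_ge0 : 0 <= chi2_const.
Proof.
rewrite /chi2_const divr_ge0 ?powR_ge0//; apply: Rintegral_ge0 => t _.
by rewrite mulr_ge0 ?powR_ge0 ?expR_ge0.
Qed.

Lemma cond_pdfE v s : 0 < v -> 0 < s ->
  cond_pdf k v s = chi2_const * s `^ (h - 1) * invgamma h (h * s) v.
Proof.
move=> v0 s0; have k0 : 0 < k%:R :> R by rewrite ltr0n.
rewrite /cond_pdf /chi2_pdf !divr_gt0 ?mulr_gt0//.
have kv0 : 0 < k%:R / v by rewrite divr_gt0.
have -> : k%:R * s / v = k%:R / v * s by rewrite mulrAC.
have -> : - (k%:R / v * s) / 2 = - (h * s / v) by field; rewrite gt_eqF.
rewrite powRM ?ltW//.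
have powE : k%:R / v * (k%:R / v) `^ (h - 1) = 2 `^ h * h `^ h * v `^ (- h).
  rewrite -{1}(powRr1 (ltW kv0)) -powRD; last by rewrite (gt_eqF kv0) implybT.
  rewrite addrC subrK -powRM ?ltW// (_ : 2 * h = k%:R); last by field.
  by rewrite powRM ?ltW ?invr_gt0// -(powR_inv1 (ltW v0)) -powRrM mulN1r.
rewrite !mulrA powE /chi2_const /invgamma invfM.
have two_neq0 : (2 : R) `^ h != 0 by rewrite gt_eqF ?powR_gt0.
by move: (Gamma_fun h)^-1 => Ginv; field.
Qed.

Lemma cond_pdf_v0 v s : v <= 0 -> 0 < s -> cond_pdf k v s = 0.
Proof.
rewrite le_eqVlt => /predU1P[->|v0] s0; first by rewrite /cond_pdf invr0 mulr0 mul0r.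
have ksv : k%:R * s / v <= 0.
  by rewrite mulr_ge0_le0 ?invr_le0 ?(ltW v0)// mulr_ge0// ltW.
by rewrite /cond_pdf /chi2_pdf ltNge ksv mulr0.
Qed.

Lemma cond_pdf_s0 v s : 0 < v -> s <= 0 -> cond_pdf k v s = 0.
Proof.
move=> v0 s0; have ksv : k%:R * s / v <= 0.
  by rewrite mulr_le0_ge0 ?invr_ge0 ?(ltW v0)// mulr_ge0_le0.
by rewrite /cond_pdf /chi2_pdf ltNge ksv mulr0.
Qed.

(** [cond_pdf] is negative when both arguments are; cutting it off outside the
    positive quadrant makes Tonelli's theorem applicable. *)
Definition pos_pdf v s : R := if (0 < v) && (0 < s) then cond_pdf k v s else 0.

Lemma pos_pdfE v s : 0 < v -> pos_pdf v s = cond_pdf k v s.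
Proof.
move=> v0; rewrite /pos_pdf v0 /=; case: ifPn => //.
by rewrite -leNgt => s0; rewrite cond_pdf_s0.
Qed.

Lemma pos_pdf_ge0 v s : 0 <= pos_pdf v s.
Proof.
rewrite /pos_pdf; case: ifPn => // /andP[v0 s0]; rewrite cond_pdfE//.
by rewrite mulr_ge0 ?invgamma_ge0// mulr_ge0 ?powR_ge0// chi2_const_ge0.
Qed.

Lemma measurable_pos_pdf : measurable_fun setT (fun p : R * R => pos_pdf p.1 p.2).
Proof.
rewrite (_ : (fun p => _) = fun p : R * R => if (0 < p.1) && (0 < p.2) then
    chi2_const * p.2 `^ (h - 1) * invgamma h (h * p.2) p.1 else 0); last first.
  apply/funext => p; rewrite /pos_pdf; case: ifPn => // /andP[v0 s0].
  by rewrite cond_pdfE.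
apply: measurable_fun_ifT => //.
  apply: measurable_and; exact: measurable_fun_ltr.
apply: measurable_funM.
  apply: measurable_funM => //; exact: (measurableT_comp (measurable_powR _)).
have mf : measurable_fun setT (fun p : R * R => (h * p.2, p.1)).
  by apply/measurable_fun_pair => //=; exact: measurable_funM.
exact: (measurableT_comp (measurable_invgamma h) mf).
Qed.

(** For v <= 0 both integrands vanish on the half line, with 1 / 0 = 0 in the
    case v = 0; hence the identity for every v, not only for almost every one. *)
Lemma cond_lawE v (B : set R) :
  cond_law k v B = (\int[mu]_(s in B) (pos_pdf v s)%:E)%E.
Proof.
rewrite /cond_law integral_mkcondr; apply: eq_integral => s _.
rewrite patchE /pos_pdf; have [v0|v0] := ltP 0 v; last first.
  case: ifPn => // /[!inE] /half_lineP s0; by rewrite cond_pdf_v0.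
have [s0|s0] /= := ltP 0 s; first by rewrite mem_set//; exact/half_lineP.
by rewrite memNset// => /half_lineP; rewrite ltNge s0.
Qed.

Lemma marginal_pdfE g s : prior_density g -> 0 < s ->
  marginal_pdf k g s =
  chi2_const * s `^ (h - 1) * invgamma_transform g h (h * s).
Proof.
move=> gp s0; have hs0 : 0 < h * s by rewrite mulr_gt0.
rewrite -[RHS](@RintegralZl _ _ R mu _ _ _ measurable_half_line); last first.
  exact: integrable_invgamma.
by apply: eq_Rintegral => v /[!inE] /half_lineP v0; rewrite cond_pdfE// mulrA.
Qed.

End chi2.

Lemma is_derive_eq_pos (R : realType) (f F : R -> R) (s df : R) :
  (forall t, 0 < t -> F t = f t) -> 0 < s -> is_derive s 1 F df ->
  is_derive s 1 f df.
Proof.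
move=> fF s0; apply: near_eq_is_derive; near=> t; apply: fF.
by near: t; exact: lt_nbhsr.
Unshelve. all: by end_near. Qed.

Section marginal_derivatives.
Context (R : realType) (k : nat) (g : R -> R).
Hypotheses (k_gt0 : (0 < k)%N) (gp : prior_density g).
Implicit Types s t : R.

Local Notation h := (k%:R / 2 : R).

Let h_gt0 : 0 < h. Proof. by rewrite divr_gt0// ltr0n. Qed.

Let T (b s : R) := invgamma_transform g b (h * s).

(* f is, up to a constant, of the form s^a T_b(hs), and this family is stable
   under differentiation up to linear combinations. *)
Let is_derive_powT (a b s : R) : 0 < b -> 0 < s ->
  is_derive s 1 (fun t => t `^ a * T b t)
    (a * (s `^ (a - 1) * T b s) - h * (s `^ a * T (b + 1) s)).
Proof.
move=> b0 s0.
have hs0 : 0 < h * s by rewrite mulr_gt0.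
have dlin : is_derive s 1 (fun t : R => h * t) h.
  rewrite (_ : (fun t => _) = h \*: (id : R -> R)); last by apply/funext.
  by apply: is_derive_eq; rewrite /GRing.scale /= mulr1.
have dT := @is_derive1_comp R (invgamma_transform g b) (fun t => h * t) s _ _
  (is_derive_invgamma_transform gp b0 hs0) dlin.
have dpow := is_derive1_powR a s0.
rewrite (_ : (fun t => _) =
    ((@powR R ^~ a) * (invgamma_transform g b \o (fun t => h * t)))); last first.
  by apply/funext.
apply: is_derive_eq; rewrite /GRing.scale /= /T; ring.
Qed.

Local Notation C := (chi2_const R k).
Local Notation f := (marginal_pdf k g).

Let f1 s := C * ((h - 1) * (s `^ (h - 1 - 1) * T h s) -
  h * (s `^ (h - 1) * T (h + 1) s)).

Let f2 s := C * ((h - 1) * ((h - 1 - 1) * (s `^ (h - 1 - 1 - 1) * T h s) -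
    h * (s `^ (h - 1 - 1) * T (h + 1) s)) -
  h * ((h - 1) * (s `^ (h - 1 - 1) * T (h + 1) s) -
    h * (s `^ (h - 1) * T (h + 1 + 1) s))).

Let is_derive_f s : 0 < s -> is_derive s 1 f (f1 s).
Proof.
move=> s0.
apply: (@is_derive_eq_pos _ _ (C \*: ((fun t => t `^ (h - 1) * T h t) : R -> R))) => //.
  by move=> t t0 /=; rewrite marginal_pdfE// /T /GRing.scale /= mulrA.
have := is_derive_powT (h - 1) h_gt0 s0 => ?.
exact: is_derive_eq.
Qed.

Let is_derive_f1 s : 0 < s -> is_derive s 1 f^`()%classic (f2 s).
Proof.
move=> s0; have h1_gt0 : 0 < h + 1 by rewrite addr_gt0.
have d0 := is_derive_powT (h - 1 - 1) h_gt0 s0.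
have d1 := is_derive_powT (h - 1) h1_gt0 s0.
apply: (@is_derive_eq_pos _ _ (C \*:
  ((h - 1) \*: ((fun t => t `^ (h - 1 - 1) * T h t) : R -> R) -
   h \*: ((fun t => t `^ (h - 1) * T (h + 1) t) : R -> R)))) => //.
by move=> t t0; rewrite derive1E; have [_ ->] := is_derive_f t0.
Qed.

Lemma derivable_marginal_pdf s : 0 < s ->
  derivable f s 1 /\ derivable f^`()%classic s 1.
Proof.
by move=> s0; have [? _] := is_derive_f s0; have [? _] := is_derive_f1 s0.
Qed.

(** Both sides of the fraction are the same multiple C k^2 s^(h + 1) of an
    inverse-gamma transform; all lower order terms cancel since 2 h = k. *)
Lemma bayes_formulaE s : 0 < s -> C != 0 ->
  bayes_formula k f s = T (h + 1) s / T (h + 1 + 1) s.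
Proof.
move=> s0 C0.
have h11 : 0 < h + 1 + 1 by rewrite !addr_gt0.
have T2_neq0 : T (h + 1 + 1) s != 0.
  by rewrite gt_eqF// invgamma_transform_gt0// mulr_gt0.
have powS a : s `^ a = s * s `^ (a - 1).
  rewrite -{2}(powRr1 (ltW s0)) -powRD; last by rewrite (gt_eqF s0) implybT.
  by rewrite addrC subrK.
have df : f^`()%classic s = f1 s by rewrite derive1E; have [] := is_derive_f s0.
have ddf : f^`(2)%classic s = f2 s.
  by rewrite derive1nS derive1n1 derive1E; have [] := is_derive_f1 s0.
rewrite /bayes_formula ddf df.
rewrite marginal_pdfE// -/(T h s) /f1 /f2 [s `^ (h - 1)]powS.
rewrite [s `^ (h - 1 - 1)]powS.
set A := s `^ (h - 1 - 1 - 1).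
have A_neq0 : A != 0 by rewrite gt_eqF// powR_gt0.
pose X := C * A * s ^+ 4 * k%:R ^+ 2.
have X_neq0 : X != 0.
  have k_neq0 : k%:R != 0 :> R by rewrite pnatr_eq0 -lt0n.
  apply: mulf_neq0 (expf_neq0 _ k_neq0).
  by apply: mulf_neq0 (expf_neq0 _ (lt0r_neq0 s0)); exact: mulf_neq0.
move: (T h s) (T (h + 1) s) (T (h + 1 + 1) s) T2_neq0 => T0 T1 T2 T2_neq0.
transitivity (X * T1 / (X * T2)); first by congr (_ / _); rewrite /X; field.
by rewrite -mulf_div divff// mul1r.
Qed.

End marginal_derivatives.

(** * Random variables with a density on the half line *)

(** [lebesgue_measure] is a measure for the Borel structure generated by
    half-open intervals; this is the same measure for the canonical structure of
    R, which is the one of random variables and of tuples. *)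
Lemma exists_lebesgue_measure_on_R (R : realType) :
  exists m : {sigma_finite_measure set R -> \bar R},
    forall (D : set R) (f : R -> \bar R), measurable D ->
      measurable_fun setT f -> (forall x, 0 <= f x)%E ->
      (\int[m]_(x in D) f x = \int[lebesgue_measure]_(x in D) f x)%E.
Proof.
pose i : measurableTypeR R -> R := id.
have mi : measurable_fun setT i by move=> _ A mA; rewrite setTI; exact: mA.
pose M0 : {measure set R -> \bar R} := pushforward (@lebesgue_measure R) i.
have sf : sigma_finite setT (M0 mi) by exact: (sigma_finiteT (@lebesgue_measure R)).
pose M : {sigma_finite_measure set R -> \bar R} :=
  HB.pack (Measure.sort (M0 mi)) (Measure_isSigmaFinite.Build _ _ _ (M0 mi) sf).
exists M => D f mD mf f0.
rewrite (@ge0_integral_pushforward _ _ _ _ _ i mi lebesgue_measure D)//.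
exact: measurable_funTS.
Qed.

Lemma fubini_tonelli_on d1 d2 (T1 : measurableType d1) (T2 : measurableType d2)
    (R : realType) (m1 : {sigma_finite_measure set T1 -> \bar R})
    (m2 : {sigma_finite_measure set T2 -> \bar R}) (D1 : set T1) (D2 : set T2)
    (f : T1 * T2 -> \bar R) :
  measurable D1 -> measurable D2 -> measurable_fun setT f ->
  (forall p, 0 <= f p)%E ->
  (\int[m1]_(x in D1) \int[m2]_(y in D2) f (x, y) =
   \int[m2]_(y in D2) \int[m1]_(x in D1) f (x, y))%E.
Proof.
move=> mD1 mD2 mf f0.
pose F (p : T1 * T2) := (f p * (\1_D1 p.1)%:E * (\1_D2 p.2)%:E)%E.
have mI1 : measurable_fun setT (fun x => (\1_D1 x)%:E : \bar R).
  exact/measurable_EFinP.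
have mI2 : measurable_fun setT (fun y => (\1_D2 y)%:E : \bar R).
  exact/measurable_EFinP.
have I0 (T : Type) (D : set T) x : (0 <= (\1_D x)%:E :> \bar R)%E.
  by rewrite lee_fin.
have mF : measurable_fun setT F.
  apply: emeasurable_funM; last exact: (measurableT_comp mI2).
  by apply: emeasurable_funM => //; exact: (measurableT_comp mI1).
have F0 p : (0 <= F p)%E by rewrite /F !mule_ge0.
have mf1 x : measurable_fun setT (fun y => f (x, y)).
  exact: (measurableT_comp mf (pair1_measurable x)).
have mf2 y : measurable_fun setT (fun x => f (x, y)).
  exact: (measurableT_comp mf (pair2_measurable y)).
transitivity (\int[m1]_x \int[m2]_y F (x, y))%E.
  rewrite integral_mule_indic; apply: eq_integral => x _.
  rewrite integral_mule_indic -ge0_integralZr//.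
  - by apply: eq_integral => y _; rewrite /F muleAC.
  - by apply: emeasurable_funM.
  - by move=> y _; rewrite mule_ge0.
rewrite fubini_tonelli// [RHS]integral_mule_indic; apply: eq_integral => y _.
rewrite [in RHS]integral_mule_indic -ge0_integralZr//.
- by apply: emeasurable_funM.
- by move=> x _; rewrite mule_ge0.
Qed.

Section random_variable_with_density.
Context (R : realType) (g : R -> R) d (Omega : measurableType d)
  (P : probability Omega R) (X : {RV P >-> R}).
Hypotheses (gp : prior_density g) (Xg : has_density_on_pos X g).

Local Notation mu := (@lebesgue_measure R).

Lemma integral_density_on_pos (f : R -> \bar R) :
  measurable_fun setT f -> (forall v, 0 <= f v)%E ->
  (\int[P]_w f (X w) = \int[mu]_(v in half_line R) (f v * (g v)%:E))%E.
Proof.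
move=> mf f0; have [mg g0 _] := gp; have mH := @measurable_half_line R.
have [m mE] := exists_lebesgue_measure_on_R R.
pose rho := (EFin \o g) \_ (half_line R).
have mrho : measurable_fun setT rho.
  by apply/(measurable_restrictT _ mH); exact/measurable_EFinP.
have rho0 v : (0 <= rho v)%E.
  rewrite /rho patchE; case: ifPn => // /[!inE] /half_lineP v0.
  by rewrite lee_fin g0.
have lawE A : measurable A ->
    distribution P X A = (\int[m]_(v in A) rho v)%E.
  move=> mA; rewrite mE// /rho -integral_mkcondr; exact: Xg.
transitivity (\int[distribution P X]_v f v)%E.
  by rewrite ge0_integral_distribution.
rewrite (ge0_integral_of_density mrho rho0 lawE)// mE//; last 2 first.
- exact: emeasurable_funM.
- by move=> v; rewrite mule_ge0.
rewrite [RHS]integral_mkcond; apply: eq_integral => v _.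
by rewrite /rho !patchE; case: ifPn => // _; rewrite mule0.
Qed.

Lemma ae_density_on_pos_gt0 : {ae P, forall w, 0 < X w}.
Proof.
exists (X @^-1` `]-oo, 0]); split.
- by rewrite -[Y in measurable Y]setTI; exact: measurable_funP.
- have disj : `]-oo, 0]%classic `&` half_line R = set0.
    apply/seteqP; split => // v [/=]; rewrite in_itv/= => v0 /half_lineP.
    by rewrite ltNge v0.
  by rewrite (Xg (measurable_itv _)) disj integral_set0.
- by move=> w /= /negP; rewrite in_itv/= leNgt.
Qed.

End random_variable_with_density.

(** * The posterior expected loss and its minimiser *)

Section posterior.
Context (R : realType) (k N : nat) (g : R -> R) (d : measure_display)
  (Omega : measurableType d) (P : probability Omega R)
  (sigma2 s2 : 'I_N -> {RV P >-> R}).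
Hypotheses (k_gt0 : (0 < k)%N) (gp : prior_density g)
  (model : hierarchical_model k g sigma2 s2).

Local Notation h := (k%:R / 2 : R).
Local Notation C := (chi2_const R k).
Local Notation V := (random_vector sigma2).
Local Notation S := (random_vector s2).
Local Notation mu := (@lebesgue_measure R).

Let h_gt0 : 0 < h. Proof. by rewrite divr_gt0// ltr0n. Qed.

Definition pos_likelihood (x v : N.-tuple R) : R :=
  \prod_(i < N) pos_pdf k (tnth v i) (tnth x i).

Lemma pos_likelihood_ge0 x v : 0 <= pos_likelihood x v.
Proof. by apply: prodr_ge0 => i _; exact: pos_pdf_ge0. Qed.

Lemma EFin_pos_likelihood x v : (pos_likelihood x v)%:E =
  (\prod_(i < N) (pos_pdf k (tnth v i) (tnth x i))%:E)%E.
Proof. by rewrite prodEFin. Qed.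

Lemma measurable_pos_likelihood :
  measurable_fun setT
    (fun p : N.-tuple R * N.-tuple R => (pos_likelihood p.2 p.1)%:E).
Proof.
under eq_fun do rewrite EFin_pos_likelihood.
apply: emeasurable_prod => i; apply/measurable_EFinP.
pose f (p : N.-tuple R * N.-tuple R) := (tnth p.1 i, tnth p.2 i).
have mf : measurable_fun setT f.
  apply/measurable_fun_pair; apply: (measurableT_comp (measurable_tnth i)) => //.
exact: (measurableT_comp (measurable_pos_pdf k_gt0) mf).
Qed.

Lemma measurable_cond_pdf (s : R) :
  measurable_fun setT (fun v : R => cond_pdf k v s).
Proof.
have mchi2 : measurable_fun setT (@chi2_pdf R k).
  apply: measurable_fun_ifT => //; first exact: measurable_fun_ltr.
  apply: measurable_funM => //; apply: measurable_funM => //.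
  apply: (measurableT_comp (@measurable_expR R)).
  by apply: measurable_funM => //; exact: oppr_measurable.
apply: measurable_funM.
  by apply: measurable_funM => //; exact: measurable_invr.
apply: (measurableT_comp mchi2).
by apply: measurable_funM => //; exact: measurable_invr.
Qed.

Lemma measurable_likelihood x :
  measurable_fun setT (fun v : N.-tuple R => (likelihood k x v)%:E).
Proof.
under eq_fun do rewrite -prodEFin.
apply: emeasurable_prod => i; apply/measurable_EFinP.
exact: (measurableT_comp (measurable_cond_pdf _) (measurable_tnth i)).
Qed.

Lemma ae_likelihoodE :
  {ae P, forall w, forall x, likelihood k x (V w) = pos_likelihood x (V w)}.
Proof.
have [dens _ _] := model.
have : {ae P, forall w, forall i, 0 < sigma2 i w}.
  by apply: filter_forall => i; exact: ae_density_on_pos_gt0 (dens i).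
apply: filterS => w w0 x; apply: eq_bigr => i _.
by rewrite pos_pdfE// tnth_mktuple w0.
Qed.

Lemma integral_likelihood (L : N.-tuple R -> R) x : measurable_fun setT L ->
  (\int[P]_w (L (V w) * likelihood k x (V w))%:E =
   \int[P]_w ((L (V w))%:E * (pos_likelihood x (V w))%:E))%E.
Proof.
move=> mL; have mV := measurable_random_vector sigma2.
have mLV : measurable_fun setT (fun w => (L (V w))%:E).
  by apply/measurable_EFinP; exact: (measurableT_comp mL).
apply: ae_eq_integral => //.
- under eq_fun do rewrite EFinM; apply: emeasurable_funM => //.
  exact: (measurableT_comp (measurable_likelihood x)).
- apply: emeasurable_funM => //.
  apply: (measurableT_comp _ mV (f := fun v => (pos_likelihood x v)%:E)).
  exact: (measurableT_comp measurable_pos_likelihood (pair2_measurable x)).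
by apply: filterS ae_likelihoodE => w lw _; rewrite lw EFinM.
Qed.

Lemma measurable_loss1 (a : N.-tuple R) :
  measurable_fun setT (fun v : N.-tuple R => loss1 v a).
Proof.
apply: measurable_sum => i; apply: measurable_funX; apply: measurable_funB => //.
apply: measurable_funM => //.
exact: (measurableT_comp (@measurable_invr R) (measurable_tnth i)).
Qed.

Lemma posterior_expected_lossE x a :
  posterior_expected_loss k sigma2 (@loss1 R N) x a =
  ((\int[P]_w ((loss1 (V w) a)%:E * (pos_likelihood x (V w))%:E)) /
   \int[P]_w (pos_likelihood x (V w))%:E)%E.
Proof.
rewrite /posterior_expected_loss; congr (_ / _)%E.
  exact: (integral_likelihood x (measurable_loss1 a)).
transitivity (\int[P]_w (cst 1 (V w) * likelihood k x (V w))%:E)%E.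
  by apply: eq_integral => w _; rewrite mul1r.
rewrite integral_likelihood//.
by apply: eq_integral => w _; rewrite mul1e.
Qed.

(** Each factor 1 / v raises the index of the inverse-gamma kernel by one. *)
Lemma integral_pos_pdf_moment i (s c0 c1 c2 : R) : 0 < s ->
  (forall v, 0 <= c2 * v^-1 ^+ 2 + c1 * v^-1 + c0) ->
  (\int[P]_w ((c2 * (sigma2 i w)^-1 ^+ 2 + c1 * (sigma2 i w)^-1 + c0) *
      pos_pdf k (sigma2 i w) s)%:E)%E =
  (C * s `^ (h - 1) * (c2 * invgamma_transform g (h + 1 + 1) (h * s) +
    c1 * invgamma_transform g (h + 1) (h * s) +
    c0 * invgamma_transform g h (h * s)))%:E.
Proof.
move=> s0 psi0; have [dens _ _] := model.
pose psi (v : R) := c2 * v^-1 ^+ 2 + c1 * v^-1 + c0.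
have mpsi : measurable_fun setT psi.
  have mI := @measurable_invr R.
  apply: measurable_funD => //; apply: measurable_funD; apply: measurable_funM => //.
  exact: measurable_funX.
pose f v := (psi v * pos_pdf k v s)%:E.
rewrite -[LHS]/(\int[P]_w f (sigma2 i w))%E.
rewrite (integral_density_on_pos gp (dens i)); last 2 first.
- apply/measurable_EFinP; apply: measurable_funM => //.
  exact: (measurableT_comp (measurable_pos_pdf k_gt0) (pair2_measurable s)).
- by move=> v; rewrite lee_fin mulr_ge0 ?psi0 ?pos_pdf_ge0.
have hs0 : 0 < h * s by rewrite mulr_gt0.
pose I b (v : R) := invgamma b (h * s) v * g v.
have i0 : mu.-integrable (half_line R) (EFin \o I h) by exact: integrable_invgamma.
have i1 : mu.-integrable (half_line R) (EFin \o I (h + 1)).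
  by apply: integrable_invgamma => //; rewrite addr_gt0.
have i2 : mu.-integrable (half_line R) (EFin \o I (h + 1 + 1)).
  by apply: integrable_invgamma => //; rewrite !addr_gt0.
have mH := @measurable_half_line R.
have iZ c b : mu.-integrable (half_line R) (EFin \o I b) ->
    mu.-integrable (half_line R) (EFin \o (fun v => c * I b v)).
  move=> ib; have ic := integrableZl _ c ib.
  exact: (ic mH).
have i21 : mu.-integrable (half_line R)
    (EFin \o (fun v => c2 * I (h + 1 + 1) v + c1 * I (h + 1) v)).
  by apply: (integrableD _ (iZ c2 _ i2) (iZ c1 _ i1)).
have i210 : mu.-integrable (half_line R) (EFin \o
    (fun v => c2 * I (h + 1 + 1) v + c1 * I (h + 1) v + c0 * I h v)).
  by apply: (integrableD _ i21 (iZ c0 _ i0)).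
transitivity (\int[mu]_(v in half_line R) ((C * s `^ (h - 1))%:E *
  (c2 * I (h + 1 + 1) v + c1 * I (h + 1) v + c0 * I h v)%:E))%E.
  apply: eq_integral => v /[!inE] /half_lineP v0.
  rewrite /f /psi pos_pdfE// cond_pdfE// -!EFinM /I !invgammaD1//.
  by congr EFin; ring.
rewrite [LHS](@integralZl _ _ R mu _ mH _ i210) [RHS]EFinM; congr (_ * _)%E.
rewrite -[LHS]fineK; last exact: (integrable_fin_num _ i210).
congr EFin.
transitivity (\int[mu]_(v in half_line R)
  (c2 * I (h + 1 + 1) v + c1 * I (h + 1) v + c0 * I h v)) => //.
rewrite (@RintegralD _ _ R mu _ _ _ mH i21 (iZ c0 _ i0)).
rewrite (@RintegralD _ _ R mu _ _ _ mH (iZ c2 _ i2) (iZ c1 _ i1)).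
rewrite (@RintegralZl _ _ R mu _ _ c2 mH i2).
rewrite (@RintegralZl _ _ R mu _ _ c1 mH i1).
by rewrite (@RintegralZl _ _ R mu _ _ c0 mH i0).
Qed.

Definition pos_marginal (s : R) : R := if 0 < s then marginal_pdf k g s else 0.

Lemma measurable_pos_pdf_l s :
  measurable_fun setT (fun v => (pos_pdf k v s)%:E : \bar R).
Proof.
apply/measurable_EFinP.
exact: (measurableT_comp (measurable_pos_pdf k_gt0) (pair2_measurable s)).
Qed.

Lemma measurable_pos_pdf_r v :
  measurable_fun setT (fun s => (pos_pdf k v s)%:E : \bar R).
Proof.
apply/measurable_EFinP.
exact: (measurableT_comp (measurable_pos_pdf k_gt0) (pair1_measurable v)).
Qed.

Lemma integral_pos_pdf i s :
  (\int[P]_w (pos_pdf k (sigma2 i w) s)%:E)%E = (pos_marginal s)%:E.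
Proof.
rewrite /pos_marginal; have [s0|s0] := ltP 0 s; last first.
  rewrite integral0_eq// => w _.
  by rewrite /pos_pdf [0 < s]ltNge s0 andbF.
rewrite marginal_pdfE//.
have := @integral_pos_pdf_moment i s 1 0 0 s0.
rewrite !mul0r !add0r mul1r => <-.
  by apply: eq_integral => w _; rewrite !mul0r !add0r mul1r.
by move=> v; rewrite !mul0r !add0r ler01.
Qed.

Lemma integral_pos_likelihood x :
  (\int[P]_w (pos_likelihood x (V w))%:E)%E =
  (\prod_(i < N) pos_marginal (tnth x i))%:E.
Proof.
have [_ ind _] := model.
transitivity (\int[P]_w \prod_(i < N) (pos_pdf k (sigma2 i w) (tnth x i))%:E)%E.
  apply: eq_integral => w _; rewrite EFin_pos_likelihood.
  by apply: eq_bigr => i _; rewrite tnth_mktuple.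
rewrite (mutually_independent_integral_prod
  (h := fun i v => (pos_pdf k v (tnth x i))%:E) ind).
- by rewrite -prodEFin; apply: eq_bigr => i _; exact: integral_pos_pdf.
- by move=> i; exact: measurable_pos_pdf_l.
- by move=> i v; rewrite lee_fin pos_pdf_ge0.
Qed.

(** The data lie somewhere with probability 1, so that the conditional density
    cannot vanish identically. *)
Lemma chi2_const_neq0 : (0 < N)%N -> C != 0.
Proof.
move=> N0; apply/eqP => C0; have [_ _ cond] := model.
have pdf0 (v s : R) : pos_pdf k v s = 0.
  rewrite /pos_pdf; case: ifPn => // /andP[v0 s0].
  by rewrite cond_pdfE// C0 !mul0r.
have := cond setT (fun=> setT) measurableT (fun=> measurableT).
rewrite (_ : _ `&` _ = setT); last by apply/seteqP; split.
rewrite probability_setT integral0_eq; first by move/eqP; rewrite onee_eq0.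
move=> w _; rewrite (bigD1 (Ordinal N0))//= cond_lawE integral0_eq ?mul0e//.
by move=> s _; rewrite pdf0.
Qed.

Lemma joint_law_density :
  exists m : {sigma_finite_measure set (N.-tuple R) -> \bar R},
  forall A B, measurable A -> measurable B ->
  P (V @^-1` A `&` S @^-1` B) =
  (\int[P]_(w in V @^-1` A) \int[m]_(x in B) (pos_likelihood x (V w))%:E)%E.
Proof.
have [_ _ cond] := model.
have [leb lebE] := exists_lebesgue_measure_on_R R.
have [m mE] := exists_product_measure_tuple (fun _ : 'I_N => leb).
exists m => A B mA mB.
have mV := measurable_random_vector sigma2.
have mS := measurable_random_vector s2.
have mVA : measurable (V @^-1` A).
  by rewrite -[X in measurable X]setTI; exact: mV.
have mlik : measurable_fun setT
    (fun p : Omega * N.-tuple R => (pos_likelihood p.2 (V p.1))%:E).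
  have mf : measurable_fun setT (fun p : Omega * N.-tuple R => (V p.1, p.2)).
    by apply/measurable_fun_pair => //; exact: (measurableT_comp mV).
  exact: (measurableT_comp measurable_pos_likelihood mf).
have lik0 x v : (0 <= (pos_likelihood x v)%:E)%E.
  by rewrite lee_fin pos_likelihood_ge0.
(* Both sides are measures in B, the left one being finite, hence it suffices
   to compare them on boxes. *)
have mI : measurable_fun setT (fun w => (\1_(V @^-1` A) w)%:E : \bar R).
  exact/measurable_EFinP.
have I0 w : (0 <= (\1_(V @^-1` A) w)%:E :> \bar R)%E by rewrite lee_fin.
pose PA := density_measure P mI I0.
pose m1 : {measure set (N.-tuple R) -> \bar R} := pushforward PA S.
pose q x := (\int[P]_(w in V @^-1` A) (pos_likelihood x (V w))%:E)%E.
have mq : measurable_fun setT q.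
  rewrite (_ : q = fubini_G P (fun p => (pos_likelihood p.2 (V p.1))%:E *
      (\1_(V @^-1` A) p.1)%:E))%E; last first.
    by apply/funext => x; rewrite /q integral_mule_indic.
  apply: measurable_fun_fubini_tonelli_G => //.
    by apply: emeasurable_funM => //; exact: (measurableT_comp mI).
  by move=> p; rewrite mule_ge0.
have q0 x : (0 <= q x)%E by exact: integral_ge0.
pose m2 : {measure set (N.-tuple R) -> \bar R} := density_measure m mq q0.
have m1E D : measurable D -> m1 mS D = P (V @^-1` A `&` S @^-1` D).
  move=> mD; have mSD : measurable (S @^-1` D).
    by rewrite -[X in measurable X]setTI; exact: mS.
  have -> : m1 mS D = (\int[P]_(w in S @^-1` D) (\1_(V @^-1` A) w)%:E)%E by [].
  by rewrite (integral_indic P mSD mVA).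
have m2E D : measurable D -> m2 D =
    (\int[P]_(w in V @^-1` A) \int[m]_(x in D) (pos_likelihood x (V w))%:E)%E.
  move=> mD; rewrite (fubini_tonelli_on P m mVA mD mlik)// => p; exact: lik0.
rewrite -m1E// -m2E//.
move: B mB; apply: eq_measure_boxes.
  rewrite m1E//; apply: (le_lt_trans (probability_le1 _ _)); last exact: ltry.
  by rewrite preimage_setT setIT.
move=> B mB; have mbB := measurable_box mB; rewrite m1E// m2E//.
rewrite (_ : S @^-1` box B = [set w | forall i, B i (s2 i w)]); last first.
  apply/seteqP; split => w /= Bw i; have := Bw i; by rewrite ?tnth_mktuple.
rewrite cond//; apply: eq_integral => w _.
rewrite integral_mule_indic.
under [RHS]eq_integral => x _.
  rewrite indic_box EFin_pos_likelihood -big_split /=.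
  over.
rewrite (mE (fun i s => (pos_pdf k (tnth (V w) i) s)%:E * (\1_(B i) s)%:E)%E).
- apply: eq_bigr => i _; rewrite cond_lawE -lebE//.
  + by rewrite integral_mule_indic tnth_mktuple.
  + exact: measurable_pos_pdf_r.
  + by move=> s; rewrite lee_fin pos_pdf_ge0.
- move=> i; apply: emeasurable_funM; first exact: measurable_pos_pdf_r.
  exact/measurable_EFinP.
- by move=> i s; rewrite mule_ge0// lee_fin pos_pdf_ge0.
Qed.

Lemma posterior_expected_loss_is_cond_expectation a :
  cond_expectation_version P S (fun w => (loss1 (V w) a)%:E)
    (posterior_expected_loss k sigma2 (@loss1 R N) ^~ a).
Proof.
have [m joint] := joint_law_density.
have mV := measurable_random_vector sigma2.
have mS := measurable_random_vector s2.
pose lik (p : N.-tuple R * N.-tuple R) := (pos_likelihood p.2 p.1)%:E.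
pose L (v : N.-tuple R) := (loss1 v a)%:E.
have lik0 p : (0 <= lik p)%E by rewrite lee_fin pos_likelihood_ge0.
have mL : measurable_fun setT L by apply/measurable_EFinP; exact: measurable_loss1.
have L0 v : (0 <= L v)%E by rewrite lee_fin; apply: sumr_ge0 => i _; rewrite sqr_ge0.
have den_fin x : (\int[P]_w lik (V w, x))%E \is a fin_num.
  by rewrite [X in X \is a _]integral_pos_likelihood.
have postE x : posterior_expected_loss k sigma2 (@loss1 R N) x a =
    (\int[P]_w (L (V w) * lik (V w, x)) / \int[P]_w lik (V w, x))%E.
  exact: posterior_expected_lossE.
split.
  under eq_fun do rewrite postE.
  exact: (measurable_posterior_expectation mV measurable_pos_likelihood lik0 mL L0
    den_fin).
move=> B mB; under [RHS]eq_integral do rewrite postE.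
exact: (posterior_expectationE mV mS measurable_pos_likelihood lik0 mL L0 joint
  den_fin mB).
Qed.

Let T b s := invgamma_transform g b (h * s).

(** Posterior expected loss in one coordinate: with [s] the observed value, the
    transforms of index h, h + 1 and h + 2 are, up to a common factor, the
    posterior masses of 1, 1 / sigma^2 and 1 / sigma^4. *)
Definition posterior_risk1 (s a : R) : R :=
  (a ^+ 2 * invgamma_transform g (h + 1 + 1) (h * s) -
   2 * a * invgamma_transform g (h + 1) (h * s)) /
  invgamma_transform g h (h * s) + 1.

Lemma invgamma_transforms_gt0 s : 0 < s ->
  [/\ 0 < invgamma_transform g h (h * s),
      0 < invgamma_transform g (h + 1) (h * s) &
      0 < invgamma_transform g (h + 1 + 1) (h * s)].
Proof.
move=> s0; have hs0 : 0 < h * s by rewrite mulr_gt0.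
by split; apply: invgamma_transform_gt0; rewrite ?addr_gt0.
Qed.

Lemma integral_weighted_loss1 i (s a : R) : 0 < s ->
  (\int[P]_w ((a / sigma2 i w - 1) ^+ 2 * pos_pdf k (sigma2 i w) s)%:E)%E =
  (posterior_risk1 s a * pos_marginal s)%:E.
Proof.
move=> s0; have [T0 _ _] := invgamma_transforms_gt0 s0.
have sqE (v : R) :
    (a / v - 1) ^+ 2 = a ^+ 2 * v^-1 ^+ 2 + (- (2 * a)) * v^-1 + 1.
  by move: (v^-1) => u; ring.
under eq_integral do rewrite sqE.
rewrite (integral_pos_pdf_moment i s0); last by move=> v; rewrite -sqE sqr_ge0.
rewrite /pos_marginal s0 marginal_pdfE// /posterior_risk1.
congr EFin; move/lt0r_neq0: T0.
by move: (invgamma_transform g h _) (C * _) => t0 c t0_neq0; field.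
Qed.

Lemma posterior_expected_loss_sum x a : positive_tuple x ->
  posterior_expected_loss k sigma2 (@loss1 R N) x a =
  (\sum_(i < N) posterior_risk1 (tnth x i) (tnth a i))%:E.
Proof.
move=> x0; have [_ ind _] := model.
rewrite posterior_expected_lossE integral_pos_likelihood.
set F := \prod_(i < N) pos_marginal (tnth x i).
have F_neq0 : F != 0.
  apply/prodf_neq0 => i _; rewrite /pos_marginal x0 marginal_pdfE//.
  have [T0 _ _] := invgamma_transforms_gt0 (x0 i).
  have C0 : C != 0 by apply: chi2_const_neq0; exact: leq_ltn_trans (ltn_ord i).
  apply: mulf_neq0 (lt0r_neq0 T0); apply: (mulf_neq0 C0).
  by rewrite gt_eqF ?powR_gt0.
(* The loss has one summand for each i, and the i-th one reweights only the
   i-th factor of the likelihood. *)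
pose f i j (v : R) : \bar R :=
  ((if j == i then (tnth a i / v - 1) ^+ 2 else 1) * pos_pdf k v (tnth x j))%:E.
have f0 i j v : (0 <= f i j v)%E.
  by rewrite lee_fin mulr_ge0 ?pos_pdf_ge0//; case: ifP => // _; exact: sqr_ge0.
have mf i j : measurable_fun setT (f i j).
  apply/measurable_EFinP; apply: measurable_funM; last first.
    by apply/measurable_EFinP; exact: measurable_pos_pdf_l.
  case: (j == i) => //; apply: measurable_funX; apply: measurable_funB => //.
  by apply: measurable_funM => //; exact: measurable_invr.
have numE : (\int[P]_w ((loss1 (V w) a)%:E * (pos_likelihood x (V w))%:E) =
    \sum_(i < N) \int[P]_w \prod_(j < N) f i j (sigma2 j w))%E.
  rewrite -ge0_integral_sum//; last 2 first.
  - move=> i; apply: emeasurable_prod => j.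
    exact: (measurableT_comp (mf i j)).
  - by move=> i w _; exact: prode_ge0.
  apply: eq_integral => w _; rewrite /loss1 -EFinM mulr_suml -sumEFin.
  apply: eq_bigr => i _; rewrite /f prodEFin; congr EFin.
  rewrite big_split /= -big_mkcond big_pred1_eq tnth_mktuple; congr (_ * _).
  by apply: eq_bigr => j _; rewrite tnth_mktuple.
have intE i j : (\int[P]_w f i j (sigma2 j w))%E =
    ((if j == i then posterior_risk1 (tnth x i) (tnth a i) else 1) *
     pos_marginal (tnth x j))%:E.
  rewrite /f; case: eqVneq => [->|_]; first exact: integral_weighted_loss1.
  rewrite mul1r -(integral_pos_pdf j).
  by apply: eq_integral => w _; rewrite mul1r.
have -> : (\int[P]_w ((loss1 (V w) a)%:E * (pos_likelihood x (V w))%:E) =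
    ((\sum_(i < N) posterior_risk1 (tnth x i) (tnth a i)) * F)%:E)%E.
  rewrite numE mulr_suml -sumEFin; apply: eq_bigr => i _.
  rewrite mutually_independent_integral_prod//.
  under eq_bigr do rewrite intE.
  by rewrite prodEFin big_split /= -big_mkcond big_pred1_eq.
by rewrite inver (negbTE F_neq0) -EFinM mulfK.
Qed.

(** The parabola in its vertex form. *)
Lemma posterior_risk1_square s a : 0 < s ->
  posterior_risk1 s a =
  posterior_risk1 s (T (h + 1) s / T (h + 1 + 1) s) +
  T (h + 1 + 1) s / T h s * (a - T (h + 1) s / T (h + 1 + 1) s) ^+ 2.
Proof.
move=> s0; have [T0 T1 T2] := invgamma_transforms_gt0 s0.
rewrite /posterior_risk1 /T.
move/lt0r_neq0: T0; move/lt0r_neq0: T2; move: (invgamma_transform g h _).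
move: (invgamma_transform g (h + 1) _) (invgamma_transform g (h + 1 + 1) _).
by move=> t1 t2 t0 t2_neq0 t0_neq0; field; rewrite ?t0_neq0 ?t2_neq0.
Qed.

(** The loss of any action exceeds that of the vertex by a sum of squares with
    positive weights, which vanishes only at the vertex. *)
Lemma bayes_action_unique x a : positive_tuple x ->
  bayes_action k sigma2 (@loss1 R N) x a <->
  a = [tuple bayes_formula k (marginal_pdf k g) (tnth x i) | i < N].
Proof.
move=> x0; set best := [tuple _ | i < N].
have bestE i : tnth best i =
    T (h + 1) (tnth x i) / T (h + 1 + 1) (tnth x i).
  rewrite tnth_mktuple; apply: bayes_formulaE => //.
  by apply: chi2_const_neq0; exact: leq_ltn_trans (ltn_ord i).
have w_gt0 i : 0 < T (h + 1 + 1) (tnth x i) / T h (tnth x i).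
  by have [T0 T1 T2] := invgamma_transforms_gt0 (x0 i); exact: divr_gt0.
have best0 : positive_tuple best.
  move=> i; rewrite bestE.
  by have [T0 T1 T2] := invgamma_transforms_gt0 (x0 i); exact: divr_gt0.
pose excess (b : N.-tuple R) := \sum_(i < N)
  T (h + 1 + 1) (tnth x i) / T h (tnth x i) * (tnth b i - tnth best i) ^+ 2.
have excess_ge0 b : 0 <= excess b.
  by apply: sumr_ge0 => i _; rewrite mulr_ge0 ?sqr_ge0// ltW.
have lossE b : posterior_expected_loss k sigma2 (@loss1 R N) x b =
    (posterior_expected_loss k sigma2 (@loss1 R N) x best + (excess b)%:E)%E.
  rewrite !posterior_expected_loss_sum// -EFinD -big_split /=.
  congr EFin; apply: eq_bigr => i _.
  by rewrite posterior_risk1_square// -bestE.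
split=> [[a0 amin]|->]; last first.
  by split => // b b0; rewrite (lossE b) leeDl// lee_fin.
have := amin _ best0; rewrite lossE posterior_expected_loss_sum// -EFinD lee_fin.
rewrite gerDl => excess_le0.
have /eqP : excess a = 0 by apply/eqP; rewrite eq_le excess_le0 excess_ge0.
rewrite psumr_eq0 => [/allP ex0|i _]; last by rewrite mulr_ge0 ?sqr_ge0// ltW.
apply: eq_from_tnth => i.
have := ex0 i (mem_index_enum i); rewrite /= mulf_eq0 gt_eqF//=.
by rewrite expf_eq0/= subr_eq0 => /eqP.
Qed.

End posterior.

Theorem theorem2p1 (R : realType) (k N : nat) (g : R -> R)
    (d : measure_display) (Omega : measurableType d) (P : probability Omega R)
    (sigma2 s2 : 'I_N -> {RV P >-> R})
    (k_gt0 : (0 < k)%N) (g_prior : prior_density g)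
    (model : hierarchical_model k g sigma2 s2) :
  let f := marginal_pdf k g in
  (* f is twice differentiable on (0, oo) *)
  (forall s : R, 0 < s -> derivable f s 1 /\ derivable f^`()%classic s 1) /\
  (* the posterior expected loss is the conditional expectation of the loss
     given the data *)
  (forall a : N.-tuple R, positive_tuple a ->
    cond_expectation_version P (random_vector s2)
      (fun w => (loss1 (random_vector sigma2 w) a)%:E)
      (posterior_expected_loss k sigma2 (@loss1 R N) ^~ a)) /\
  (* the Bayes rule is given by the formula *)
  (forall x a : N.-tuple R, positive_tuple x ->
    bayes_action k sigma2 (@loss1 R N) x a <->
    a = [tuple bayes_formula k f (tnth x i) | i < N]).
Proof.
split; [|split].
- by move=> s s0; exact: derivable_marginal_pdf.
- by move=> a _; exact: (posterior_expected_loss_is_cond_expectation k_gt0 g_prior model).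
- by move=> x a x0; exact: (bayes_action_unique k_gt0 g_prior model).
Qed.
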